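(* There are $2^{\aleph_0}$ (continuum many) separable (hence torsionless, hence $\aleph_1$-free) abelian non-Archimedean Polish groups $(G_\alpha : \alpha < 2^{\aleph_0})$ such that no $G_\alpha$ is topologically isomorphic to a product group, and for $\alpha \neq \beta$ there is no continuous surjective homomorphism from $G_\alpha$ onto $G_\beta$. Furthermore, all these groups can be taken to be inverse limits (over $\omega$, with the topology induced by the product topology) of countable torsion-free completely decomposable abelian groups (i.e., direct sums of torsion-free abelian groups of rank $1$).
   Context: A Polish group is non-Archimedean if it has a countable neighborhood basis at the identity consisting of open subgroups. A torsion-free abelian group $A$ is separable if every finite subset of $A$ is contained in a free direct summand of $A$; torsionless if for every $0 \neq a \in A$ there is a homomorphism $f: A \to \mathbb{Z}$ with $f(a) \neq 0$; $\aleph_1$-free if every countable subgroup is free abelian. A product group means a topological group of the form $\prod_{n<\omega} H_n$ with each $H_n$ a countable discrete group and the product topology. *)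

(* Defs.v *)
From HB Require Import structures.
From mathcomp Require Import all_boot all_order all_algebra.
From mathcomp Require Import all_classical all_reals all_analysis.

Set Implicit Arguments.
Unset Strict Implicit.
Unset Printing Implicit Defensive.

Import GRing.Theory.
Local Open Scope classical_set_scope.
Local Open Scope ring_scope.

Section AbelianGroups.
Variable A : zmodType.
Implicit Types (H F B S : set A).

Definition subgroup H := H 0 /\ forall x y, H x -> H y -> H (x - y).

Definition torsion_free := forall (x : A) (n : nat), x *+ n.+1 = 0 -> x = 0.

Definition Z_independent B :=
  forall (s : seq A) (c : A -> int), uniq s -> [set` s] `<=` B ->
    \sum_(b <- s) b *~ c b = 0 -> forall b, b \in s -> c b = 0.

Definition Z_span B : set A :=
  [set x | exists (s : seq A) (c : A -> int),
     [set` s] `<=` B /\ x = \sum_(b <- s) b *~ c b].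

Definition free_abelian F := exists2 B, Z_independent B & F = Z_span B.

Definition direct_summand F :=
  subgroup F /\
  exists C, [/\ subgroup C,
    forall x, F x -> C x -> x = 0 &
    forall x, exists y z, [/\ F y, C z & x = y + z]].

(** Separable in the sense of abelian group theory; not to be confused with
    the topological notion, which appears in [polish] below. *)
Definition separable_group :=
  torsion_free /\
  forall S, finite_set S ->
    exists F, [/\ free_abelian F, direct_summand F & S `<=` F].

Definition torsionless :=
  forall a : A, a <> 0 -> exists f : {additive A -> int}, f a <> 0.

Definition aleph1_free :=
  forall H, subgroup H -> countable H -> free_abelian H.

(** The rank of a group is the cardinality of a maximal independent subset. *)
Definition rank_one H :=
  exists a, [/\ H a, Z_independent [set a] &
    forall S, S `<=` H -> Z_independent S -> [set a] `<=` S -> S = [set a]].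

Definition internal_direct_sum (I : choiceType) (B : I -> set A) :=
  [/\ forall i, subgroup (B i),
      forall x, exists (s : seq I) (b : I -> A),
        (forall i, B i (b i)) /\ x = \sum_(i <- s) b i &
      forall (s : seq I) (b : I -> A), uniq s -> (forall i, B i (b i)) ->
        \sum_(i <- s) b i = 0 -> forall i, i \in s -> b i = 0].

Definition completely_decomposable :=
  torsion_free /\
  exists (I : choiceType) (B : I -> set A),
    internal_direct_sum B /\ forall i, rank_one (B i).

End AbelianGroups.

Definition homeomorphism (T U : topologicalType) (f : T -> U) :=
  continuous f /\ exists g : U -> T, [/\ continuous g, cancel f g & cancel g f].

Definition complete_uniform (T : uniformType) :=
  forall F : set_system T, ProperFilter F -> cauchy F -> exists x : T, F --> x.

Definition polish (R : realType) (T : topologicalType) :=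
  (exists2 D : set T, countable D & dense D) /\
  exists (M : metricType R) (f : T -> M), complete_uniform M /\ homeomorphism f.

Definition non_archimedean (G : topologicalZmodType) :=
  exists U : nat -> set G,
    (forall n, open (U n) /\ subgroup (U n)) /\
    forall V, nbhs (0 : G) V -> exists n, U n `<=` V.

(** The factors are arbitrary, a priori non-commutative, groups. *)
Definition iso_to_product_group (G : topologicalZmodType) :=
  exists (H : nat -> groupType)
         (phi : G -> prod_topology (fun n => discrete_topology (H n))),
    [/\ forall n, countable [set: H n],
        forall x y n, phi (x + y) n = (phi x n * phi y n : H n)%g &
        homeomorphism phi].

(** The inverse limit of a sequence, as a subset of the product of the discrete
    groups [A n]; the type associated with this set carries the subspace
    topology. *)
Definition inverse_limit (A : nat -> zmodType)
    (p : forall n, {additive A n.+1 -> A n}) :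
    set (prod_topology (fun n => discrete_topology (A n))) :=
  [set x | forall n, p n (x n.+1) = x n].

Definition is_inverse_limit (G : topologicalZmodType) (A : nat -> zmodType)
    (p : forall n, {additive A n.+1 -> A n}) :=
  exists phi : G -> inverse_limit p,
    (forall x y n,
      set_val (phi (x + y)) n = (set_val (phi x) n + set_val (phi y) n : A n)) /\
    homeomorphism phi.

(* Main.v *)
(* For a prime q, the sequences of integers (z_i) such that the q-adic integer
   z_0 + q z_1 + q^2 z_2 + ... is rational form a group H_q, which is Polish for
   the topology inherited from Z^omega times the discrete localization Z_(q).
   The theorem holds for the products G_S of the H_q, q in S, where S ranges
   over a family of 2^aleph_0 pairwise incomparable sets of primes.
   - G_S is pure in a power of Z, so each nonzero element is an integer multiple
     of an element mapped to 1 by some homomorphism to Z.  Torsionlessness and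
     separability follow from this property.
   - Modulo each basic neighbourhood U_n of 0, the elements of H_q whose first n
     entries vanish are divisible by every m prime to q.  If G_S were a product
     group, its projection to finitely many factors would kill some U_n, hence
     these elements, as divisibility by all such m is impossible in a power of
     Z; but some of them are not close to 0.
   - Let t in T be outside S.  A continuous homomorphism from G_S to Z_(t) kills
     some U_n.  Modulo U_n and finitely many elements, G_S is divisible by all
     powers of t, so the image is finitely generated.  Hence no continuous
     homomorphism from G_S to G_T is onto.
   - G_S / U_n is a finite direct sum of copies of Z and Z_(q), q in S. *)
Require Import Defs.
From HB Require Import structures.
From mathcomp Require Import all_boot all_order all_algebra.
From mathcomp Require Import all_classical all_reals all_analysis.
From mathcomp Require Import ring zify.

Set Implicit Arguments.
Unset Strict Implicit.
Unset Printing Implicit Defensive.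

Import Order.TTheory GRing.Theory Num.Theory.
Local Open Scope classical_set_scope.
Local Open Scope ring_scope.

(** * Integer spans and independence *)

Section Spans.
Variable A : zmodType.
Implicit Types (B H : set A) (s : seq A).

Lemma subgroup_opp {H} x : subgroup H -> H x -> H (- x).
Proof. by case=> H0 HB Hx; rewrite -sub0r; exact: HB. Qed.

Lemma subgroup_add {H} x y : subgroup H -> H x -> H y -> H (x + y).
Proof.
by move=> sH Hx Hy; rewrite -[y]opprK; apply: sH.2 => //; exact: subgroup_opp.
Qed.

Lemma subgroup_mulz {H} x k : subgroup H -> H x -> H (x *~ k).
Proof.
move=> sH Hx; have Hn n : H (x *+ n).
  elim: n => [|n IH]; first by rewrite mulr0n; exact: sH.1.
  by rewrite mulrS; exact: subgroup_add.
by case: k => n; [exact: Hn|rewrite NegzE mulrNz; apply: subgroup_opp => //; exact: Hn].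
Qed.

Lemma subgroup_sum {H} (I : eqType) (r : seq I) (F : I -> A) : subgroup H ->
  (forall i, i \in r -> H (F i)) -> H (\sum_(i <- r) F i).
Proof.
move=> sH HF; rewrite big_seq; elim/big_ind: _ => //; first exact: sH.1.
by move=> x y; exact: subgroup_add.
Qed.

(** Repetitions are merged by multiplying each coefficient by the multiplicity of its element. *)
Lemma Z_span_uniq B x : Z_span B x -> exists (s : seq A) (c : A -> int),
  [/\ uniq s, [set` s] `<=` B & x = \sum_(b <- s) b *~ c b].
Proof.
case=> s [c [sB ->]]; exists (undup s), (fun b => c b *+ count_mem b s).
split; [exact: undup_uniq|by move=> b /=; rewrite mem_undup; exact: sB|].
rewrite -big_undup_iterop_count; apply: eq_bigr => b _.
rewrite -[LHS]/((b *~ c b) *+ count_mem b s).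
by elim: (count_mem b s) => [|n IH]; rewrite ?mulr0n ?mulr0z // !mulrS mulrzDr IH.
Qed.

Lemma Z_span_extend (t s : seq A) (c : A -> int) : uniq t -> uniq s ->
  {subset s <= t} -> exists d : A -> int,
    \sum_(b <- s) b *~ c b = \sum_(b <- t) b *~ d b.
Proof.
move=> ut us st; exists (fun b => if b \in s then c b else 0).
have /permPl p := perm_filterC (mem s) t.
rewrite -[RHS](perm_big _ p) big_cat /= [X in _ = _ + X]big1_seq; last first.
  by move=> b /=; rewrite mem_filter /= => /andP[/negbTE->].
rewrite addr0 (perm_big [seq x <- t | x \in s]) /=.
  by rewrite big_seq [RHS]big_seq; apply: eq_bigr => b; rewrite mem_filter /= => /andP[->].
apply: uniq_perm => //; first exact: filter_uniq.
by move=> b; rewrite mem_filter /=; case: (boolP (b \in s)) => //= /st->.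
Qed.

Lemma Z_span_subgroup B : subgroup (Z_span B).
Proof.
split; first by exists [::], (fun=> 0); split; [move=> ?|rewrite big_nil].
move=> x y /Z_span_uniq[s [c [us sB ->]]] /Z_span_uniq[t [d [ut tB ->]]].
have uu := undup_uniq (s ++ t).
have [|c' ->] := @Z_span_extend _ s c uu us.
  by move=> b bs; rewrite mem_undup mem_cat bs.
have [|d' ->] := @Z_span_extend _ t d uu ut.
  by move=> b bs; rewrite mem_undup mem_cat bs orbT.
exists (undup (s ++ t)), (fun b => c' b - d' b); split.
  by move=> b /=; rewrite mem_undup mem_cat => /orP[/sB|/tB].
by rewrite -sumrB; apply: eq_bigr => b _; rewrite mulrzBr.
Qed.

Lemma Z_span_sub B H : subgroup H -> B `<=` H -> Z_span B `<=` H.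
Proof.
move=> sH BH x [s [c [sB ->]]]; apply: subgroup_sum => // b /sB/BH.
exact: subgroup_mulz.
Qed.

Lemma Z_span_gen B b : B b -> Z_span B b.
Proof.
move=> Bb; exists [:: b], (fun=> 1); rewrite big_seq1 mulr1z; split => // x /=.
by rewrite inE => /eqP->.
Qed.

Lemma Z_span_mono B H : B `<=` H -> Z_span B `<=` Z_span H.
Proof.
move=> BH; apply: Z_span_sub; first exact: Z_span_subgroup.
by move=> b /BH; exact: Z_span_gen.
Qed.

Lemma Z_span_head s b : Z_span [set` b :: s] b.
Proof. by apply: Z_span_gen => /=; rewrite inE eqxx. Qed.

Lemma Z_span_tail s b x : Z_span [set` s] x -> Z_span [set` b :: s] x.
Proof. by apply: Z_span_mono => y /=; rewrite inE => ->; rewrite orbT. Qed.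

Lemma Z_span_nil (x : A) : Z_span [set` [::]] x -> x = 0.
Proof.
move=> nx; suff: Z_span [set` [::]] `<=` [set (0 : A)] by exact.
by apply: Z_span_sub => [|y //]; split => // y z -> ->; rewrite subrr.
Qed.

Lemma additive_kills_span (B : set A) (C : zmodType) (g : {additive A -> C}) :
  (forall b, B b -> g b = 0) -> forall x, Z_span B x -> g x = 0.
Proof.
move=> gB; apply: (@Z_span_sub _ [set x | g x = 0]) => //.
by split=> [|y z /= gy gz] /=; rewrite ?raddf0 // raddfB gy gz subrr.
Qed.

Lemma Z_independent_nil : Z_independent [set` [::] : seq A].
Proof. by move=> s c _ sub _ b /sub. Qed.

(** Applying [g] to a relation isolates the coefficient of [b], which must vanish; the rest is a
    relation in [s]. *)
Lemma Z_independent_cons s b (g : {additive A -> int}) :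
  Z_independent [set` s] -> (forall x, x \in s -> g x = 0) -> g b != 0 ->
  Z_independent [set` b :: s].
Proof.
move=> si gs gb t c ut tsub t0.
have cb0 : b \in t -> c b = 0.
  move=> bt; have := congr1 g t0; rewrite raddf0 raddf_sum (bigD1_seq b) //=.
  rewrite big1_seq => [|x /andP[xb /tsub /=]].
    by rewrite addr0 raddfMz => /eqP; rewrite mulrzz mulf_eq0 (negbTE gb) => /eqP.
  by rewrite inE (negbTE xb) /= => /gs; rewrite raddfMz => ->; rewrite mul0rz.
have fil : \sum_(x <- t | x != b) x *~ c x = 0.
  case: (boolP (b \in t)) => bt; last first.
    rewrite -[RHS]t0 big_seq_cond [RHS]big_seq; apply: eq_bigl => x /=.
    case xt: (x \in t) => //=; case: eqP => // xb; by rewrite -xb xt in bt.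
  by move: t0; rewrite (bigD1_seq b) //= cb0 // mulr0z add0r.
move=> x xt; have [xb|xb] := eqVneq x b; first by rewrite xb cb0 // -xb.
move: fil; rewrite -big_filter => /si; apply.
- exact: filter_uniq.
- by move=> y /=; rewrite mem_filter => /andP[yb /tsub /=]; rewrite inE (negbTE yb).
- by rewrite mem_filter xb.
Qed.

End Spans.

(** * Freeness and separability from integer-valued functionals *)

Section Freeness.
Variable A : zmodType.

Definition additive_of (C : zmodType) (f : A -> C) (fB : {morph f : x y / x - y}) :
  {additive A -> C} := HB.pack f (GRing.isZmodMorphism.Build A C f fB).

Lemma torsionless_torsion_free : torsionless A ->
  forall (x : A) (m : int), m != 0 -> x *~ m = 0 -> x = 0.
Proof.
move=> tA x m m0 xm; apply: contrapT => /tA[f]; apply.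
by have /eqP := congr1 f xm; rewrite raddf0 raddfMz mulrzz mulf_eq0 (negbTE m0) orbF => /eqP.
Qed.

(* If [g1] kills the tail of the list and [g2] kills it as well, then
   [g1 b * g2 - g2 b * g1] kills [b] too. *)
Lemma functional_killing_span : torsionless A -> forall (s : seq A) (x : A),
  (forall m : int, m != 0 -> ~ Z_span [set` s] (x *~ m)) ->
  exists g : {additive A -> int}, (forall b, b \in s -> g b = 0) /\ g x <> 0.
Proof.
move=> tA; elim=> [|b s IH] x xs.
  have /tA[g gx] : x <> 0.
    move=> x0; apply: (xs 1) => //; rewrite x0 mul0rz; exact: (Z_span_subgroup _).1.
  by exists g.
have [[m m0 bm]|nb] := pselect (exists2 m : int, m != 0 & Z_span [set` s] (b *~ m)).
  have [g [gs gx]] : exists g : {additive A -> int},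
    (forall b, b \in s -> g b = 0) /\ g x <> 0.
    apply: IH => n n0 sn; apply: (xs n n0); exact: Z_span_tail sn.
  exists g; split => // y; rewrite inE => /predU1P[->|]; last exact: gs.
  have /eqP := additive_kills_span gs bm.
  by rewrite raddfMz mulrzz mulf_eq0 (negbTE m0) orbF => /eqP.
have [g1 [g1s g1b]] : exists g : {additive A -> int},
    (forall y, y \in s -> g y = 0) /\ g b <> 0.
  by apply: IH => m m0 bm; apply: nb; exists m.
pose x' := x *~ g1 b - b *~ g1 x.
have [g2 [g2s g2x]] : exists g : {additive A -> int},
    (forall y, y \in s -> g y = 0) /\ g x' <> 0.
  apply: IH => m m0 x'm; apply: (xs (g1 b * m)); first by rewrite mulf_neq0 //; apply/eqP.
  have -> : x *~ (g1 b * m) = x' *~ m + b *~ (g1 x * m).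
    by rewrite /x' mulrzBl -!mulrzA subrK.
  apply: subgroup_add; first exact: Z_span_subgroup.
    exact: Z_span_tail x'm.
  apply: subgroup_mulz; first exact: Z_span_subgroup.
  exact: Z_span_head.
have gB : {morph (fun y => g1 b * g2 y - g2 b * g1 y) : y z / y - z}.
  by move=> y z; rewrite !raddfB /= ; ring.
exists (additive_of gB); split => [y|] /=.
  rewrite inE => /predU1P[->|ys]; first by rewrite mulrC subrr.
  by rewrite (g1s y) // (g2s y) // !mulr0 subrr.
suff : g1 b * g2 x - g2 b * g1 x = g2 x' by move=> ->; exact: g2x.
by rewrite /x' raddfB !(raddfMz g2) !mulrzz; ring.
Qed.

Section CountableSubgroup.
Hypothesis tA : torsionless A.
Variable H : set A.
Hypothesis sH : subgroup H.

(** A basis of a finitely generated subgroup that is pure in [H]. Purity is what makes the basis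
    extendable. *)
Definition pure_basis (s : seq A) :=
  [/\ [set` s] `<=` H, Z_independent [set` s] &
      forall h (m : int), H h -> m != 0 -> Z_span [set` s] (h *~ m) ->
        Z_span [set` s] h].

(** If [x] is independent of [s], some [g] kills [s] but not [x]. On the pure closure [C] of [s] and
    [x] in [H], the values of [g] form a nonzero subgroup of Z, and any [b] in [C] mapped to a
    generator completes [s] to a basis of [C]. *)
Lemma pure_basis_extend s x : pure_basis s -> H x ->
  exists s', [/\ pure_basis s', Z_span [set` s'] x & s' = s \/ exists b, s' = b :: s].
Proof.
move=> [ssH si sp] Hx.
have [[m m0 xm]|nx] := pselect (exists2 m : int, m != 0 & Z_span [set` s] (x *~ m)).
  by exists s; split; [split|exact: sp xm|left].
have [g [gs gx]] : exists g : {additive A -> int},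
    (forall b, b \in s -> g b = 0) /\ g x <> 0.
  by apply: functional_killing_span => // m m0 xm; apply: nx; exists m.
have S := Z_span_subgroup [set` s].
pose C := [set h | H h /\ exists m c : int, m != 0 /\ Z_span [set` s] (h *~ m - x *~ c)].
have sC : subgroup C.
  split; first by split; [exact: sH.1|exists 1, 0; rewrite mul0rz subrr; split => //; exact: S.1].
  move=> h h' [Hh [m [c [m0 hm]]]] [Hh' [m' [c' [m'0 hm']]]].
  split; first exact: sH.2.
  exists (m * m'), (c * m' - c' * m); split; first by rewrite mulf_neq0.
  have -> : (h - h') *~ (m * m') - x *~ (c * m' - c' * m) =
            (h *~ m - x *~ c) *~ m' - (h' *~ m' - x *~ c') *~ m.
    rewrite !mulrzBl mulrzBr -!mulrzA [m' * m]mulrC !opprB.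
    by rewrite [_ - x *~ (c * m')]addrC addrACA [- (h' *~ _) + _]addrC.
  by apply: S.2; exact: subgroup_mulz.
have Cx : C x by split=> //; exists 1, 1; rewrite subrr; split => //; exact: S.1.
have sC' : forall h, h \in s -> C h.
  move=> h hs; split; first exact: ssH.
  by exists 1, 0; split => //; rewrite mulr0z subr0 mulr1z; exact: Z_span_gen.
have [b [Cb gb0 gdvd]] : exists b, [/\ C b, g b != 0 &
    forall h, C h -> exists k : int, g h = g b * k].
  (* The shift to [n.+1] restricts the search for a least absolute value to nonzero values. *)
  pose P n := `[< exists2 h, C h & `|g h|%N = n.+1 >].
  have exP : exists n, P n.
    exists (`|g x|%N.-1); apply/asboolP; exists x => //.
    by rewrite prednK // absz_gt0; apply/eqP.
  case: (ex_minnP exP) => n /asboolP[b Cb gbn] nmin.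
  have gb0 : g b != 0 by rewrite -absz_eq0 gbn.
  exists b; split => // h Ch; exists (g h %/ g b)%Z.
  have Cr : C (h - b *~ (g h %/ g b)%Z) by apply: sC.2 => //; exact: subgroup_mulz.
  have gr : g (h - b *~ (g h %/ g b)%Z) = (g h %% g b)%Z.
    by rewrite raddfB (raddfMz g) mulrzz [X in X - _](divz_eq (g h) (g b)) mulrC; ring.
  have r0 : (0 <= (g h %% g b)%Z)%R by exact: modz_ge0.
  have rb : ((g h %% g b)%Z < `|g b|)%R by exact: ltz_mod.
  rewrite [LHS](divz_eq (g h) (g b)) mulrC.
  suff -> : (g h %% g b)%Z = 0 by rewrite addr0.
  apply/eqP; apply: contraT => r_neq0.
  have : P `|(g h %% g b)%Z|%N.-1.
    apply/asboolP; exists (h - b *~ (g h %/ g b)%Z) => //.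
    by rewrite gr prednK // absz_gt0.
  move=> /nmin; lia.
have Csub h : C h -> Z_span [set` b :: s] h.
  move=> Ch; have [k gk] := gdvd h Ch.
  have [Hr [m [c [m0 rc]]]] : C (h - b *~ k) by apply: sC.2 => //; exact: subgroup_mulz.
  (* [g] kills both [s] and [h - b *~ k], so the relation reduces to [g x * c = 0]. Purity of the
     span of [s] then applies to [h - b *~ k]. *)
  have c0 : c = 0.
    have := additive_kills_span gs rc.
    rewrite raddfB !(raddfMz g) raddfB (raddfMz g) gk !mulrzz subrr mul0r sub0r => /eqP.
    by rewrite oppr_eq0 mulf_eq0 (negbTE (introN eqP gx)) => /eqP.
  move: rc; rewrite c0 mulr0z subr0 => /sp-/(_ Hr m0) hk.
  rewrite -(subrK (b *~ k) h); apply: subgroup_add; first exact: Z_span_subgroup.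
    exact: Z_span_tail hk.
  apply: subgroup_mulz; first exact: Z_span_subgroup.
  exact: Z_span_head.
exists (b :: s); split; [split| exact: Csub |by right; exists b].
- by move=> y /=; rewrite inE => /predU1P[->|/ssH //]; exact: Cb.1.
- exact: (Z_independent_cons si gs gb0).
- move=> h m Hh m0 hm; apply: Csub.
  have [_ [m' [c [m'0 hc]]]] : C (h *~ m).
    apply: (Z_span_sub sC _ hm) => y /=.
    by rewrite inE => /predU1P[->|/sC'].
  by split => //; exists (m * m'), c; rewrite mulf_neq0 // mulrzA.
Qed.

(** This is the construction behind Pontryagin's criterion: along an enumeration of [H], nested pure
    bases absorb one element at a time, and their union is a basis. *)
Lemma countable_subgroup_free : countable H -> free_abelian H.
Proof.
move=> cH.
have [e eH He] : exists2 e : nat -> A, (forall n, H (e n)) & forall h, H h -> exists n, e n = h.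
  have /pfcard_geP[H0|[e]] := cH; first by have := sH.1; rewrite H0.
  exists e => [n|h Hh]; first by apply: funS.
  by have [n _ <-] := @surj _ _ _ _ e h Hh; exists n.
have base : pure_basis [::].
  split=> [y //||h m Hh m0 /Z_span_nil hm]; first exact: Z_independent_nil.
  by rewrite (torsionless_torsion_free tA m0 hm); exact: (Z_span_subgroup _).1.
have step (n : nat) (s : {s | pure_basis s}) : exists s' : {s | pure_basis s},
    Z_span [set` sval s'] (e n) /\ (sval s' = sval s \/ exists b, sval s' = b :: sval s).
  case: s => s bs; have [s' [bs' es' ss']] := pure_basis_extend bs (eH n).
  by exists (exist _ s' bs').
pose F n := projT1 (choice (step n)); have FP n := projT2 (choice (step n)).
pose t := fix t n := if n is m.+1 then F m (t m) else exist _ [::] base.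
have tmono m n : (m <= n)%N -> [set` sval (t m)] `<=` [set` sval (t n)].
  elim: n => [|n IH]; first by rewrite leqn0 => /eqP->.
  rewrite leq_eqVlt => /predU1P[->//|/IH mn] y /mn /= yn.
  by have [_ [->|[b ->]]] := FP n (t n); rewrite ?inE ?yn ?orbT.
pose B := \bigcup_n [set` sval (t n)].
have BH : B `<=` H by move=> b [n _]; case: (svalP (t n)) => + _ _; apply.
exists B.
  move=> s c us sB s0.
  (* A relation involves finitely many elements, hence lives in a single stage of the chain. *)
  have [N sN] : exists N, [set` s] `<=` [set` sval (t N)].
    elim: s sB {us s0} => [|b s IH] sB; first by exists 0%N.
    have [N sN] : exists N, [set` s] `<=` [set` sval (t N)].
      by apply: IH => y ys; apply: sB => /=; rewrite inE ys orbT.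
    have [M _ bM] : B b by apply: sB => /=; rewrite inE eqxx.
    exists (maxn M N) => y /=; rewrite inE => /predU1P[->|ys].
      exact: (tmono _ _ (leq_maxl M N)) bM.
    exact: (tmono _ _ (leq_maxr M N)) (sN y ys).
  case: (svalP (t N)) => _ tN _; exact: tN us sN s0.
apply/seteqP; split=> h; last exact: Z_span_sub.
move=> /He[n <-]; have [en _] := FP n (t n).
by apply: Z_span_mono en => y yn; exists n.+1.
Qed.

End CountableSubgroup.

Lemma torsionless_aleph1_free : torsionless A -> aleph1_free A.
Proof. by move=> tA H sH; exact: countable_subgroup_free. Qed.

Hypothesis unimodular : forall y : A, y <> 0 ->
  exists (b : A) (m : int) (f : {additive A -> int}), y = b *~ m /\ f b = 1.

Lemma unimodular_torsionless : torsionless A.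
Proof.
move=> y y0; have [b [m [f [ym fb]]]] := unimodular y0; exists f.
rewrite ym raddfMz fb mulrzz mul1r => m0; apply: y0.
by rewrite ym m0 mulr0z.
Qed.

(** Induction on [S]: [rho] retracts onto the span built so far. Write [x - rho x = b *~ m] with
    [f b = 1]; then [b] joins the basis, and [y] is sent to [rho y + b *~ f (y - rho y)]. *)
Lemma finite_retract (S : seq A) : exists (s : seq A) (rho : {additive A -> A}),
  [/\ Z_independent [set` s], forall x, Z_span [set` s] (rho x),
      forall b, b \in s -> rho b = b & forall x, x \in S -> Z_span [set` s] x].
Proof.
elim: S => [|x S [s [rho [si rs rb Ss]]]].
  exists [::], \0; split => // x; [exact: Z_independent_nil|exact: (Z_span_subgroup _).1].
have rid y : Z_span [set` s] y -> rho y = y.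
  apply: (@Z_span_sub _ _ [set y | rho y = y]) => //.
  by split=> [|u v /= ru rv] /=; rewrite ?raddf0 // raddfB ru rv.
have [x0|x0] := eqVneq (x - rho x) 0.
  exists s, rho; split => // y; rewrite inE => /predU1P[->|/Ss //].
  by move/eqP: x0; rewrite subr_eq0 => /eqP->.
have [b [m [f [xm fb]]]] := unimodular (elimN eqP x0).
have m0 : m != 0 by apply: contra x0 => /eqP m0; rewrite xm m0 mulr0z.
(* [rho b *~ m = rho (x - rho x) = 0], and there is no torsion. *)
have rhob : rho b = 0.
  apply: (torsionless_torsion_free unimodular_torsionless m0).
  by rewrite -raddfMz -xm raddfB [rho (rho x)]rid ?subrr.
have gB : {morph (fun y => f (y - rho y)) : y z / y - z}.
  by move=> y z; rewrite !raddfB /=; ring.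
pose g := additive_of gB.
have gs y : y \in s -> g y = 0 by move=> ys; rewrite /g /= rb // subrr raddf0.
have gb : g b = 1 by rewrite /g /= rhob subr0.
have rB : {morph (fun y => rho y + b *~ g y) : y z / y - z}.
  by move=> y z; rewrite !raddfB /= opprD addrACA.
exists (b :: s), (additive_of rB); split.
- by apply: Z_independent_cons si gs _; rewrite gb.
- move=> y; apply: subgroup_add; first exact: Z_span_subgroup.
    exact: Z_span_tail (rs y).
  apply: subgroup_mulz; first exact: Z_span_subgroup.
  exact: Z_span_head.
- move=> y; rewrite inE => /predU1P[->|ys] /=.
    by rewrite -[f _]/(g b) gb rhob add0r.
  by rewrite -[f _]/(g y) gs // mulr0z addr0 rb.
- move=> y; rewrite inE => /predU1P[->|ys]; last first.
    exact: Z_span_tail (Ss y ys).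
  rewrite -(subrK (rho x) x) xm; apply: subgroup_add; first exact: Z_span_subgroup.
    apply: subgroup_mulz; first exact: Z_span_subgroup.
    exact: Z_span_head.
  exact: Z_span_tail (rs x).
Qed.

(** The kernel of the retraction is a complement of the span. *)
Lemma unimodular_separable : separable_group A.
Proof.
split=> [x n xn|S /finite_seqP[S' ->]].
  by apply: (torsionless_torsion_free unimodular_torsionless (m := n.+1)).
have [s [rho [si rs rb Ss]]] := finite_retract S'.
exists (Z_span [set` s]); split; [by exists [set` s]| |exact: Ss].
have rid y : Z_span [set` s] y -> rho y = y.
  apply: (@Z_span_sub _ _ [set y | rho y = y]) => //.
  by split=> [|u v /= ru rv] /=; rewrite ?raddf0 // raddfB ru rv.
split; first exact: Z_span_subgroup.
exists [set y | rho y = 0]; split.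
- by split=> [|u v /= ru rv] /=; rewrite ?raddf0 // raddfB ru rv subrr.
- by move=> x /rid + /= rx; rewrite rx.
- move=> x; exists (rho x), (x - rho x); split => //=; last by rewrite addrC subrK.
  by rewrite raddfB [rho (rho x)]rid ?subrr.
Qed.

End Freeness.

(** * Localizations of Z and the groups of tail sequences *)

(** For [q] prime this is the ring Z_(q); [m] is then nonzero, since [q] is not coprime to 0. *)
Definition localized (q : nat) (r : rat) :=
  exists2 m : nat, coprime q m & r * m%:R \is a Num.int.

Lemma localized_int q r : r \is a Num.int -> localized q r.
Proof. by move=> ri; exists 1%N; rewrite ?coprimen1 ?mulr1. Qed.

Lemma localizedB q r s : localized q r -> localized q s -> localized q (r - s).
Proof.
move=> [m cm rm] [n cn sn]; exists (m * n)%N; first by rewrite coprimeMr cm.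
rewrite natrM (_ : _ * _ = (r * m%:R) * n%:R - (s * n%:R) * m%:R); last by ring.
by rewrite rpredB // rpredM // rpred_nat.
Qed.

Lemma localizedM q r s : localized q r -> localized q s -> localized q (r * s).
Proof.
move=> [m cm rm] [n cn sn]; exists (m * n)%N; first by rewrite coprimeMr cm.
by rewrite natrM mulrACA rpredM.
Qed.

Lemma localizedD q r s : localized q r -> localized q s -> localized q (r + s).
Proof.
move=> lr ls; rewrite -[s]opprK; apply: localizedB => //.
by rewrite -sub0r; apply: localizedB => //; apply: localized_int; exact: rpred0.
Qed.

Lemma localizedV q (m : nat) : coprime q m -> localized q m%:R^-1.
Proof.
(* For [m = 0] the inverse is 0 by convention. *)
move=> cm; exists m => //; have [->|m0] := eqVneq m 0%N.
  by rewrite mulr0 rpred0.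
by rewrite mulVf ?rpred1 // pnatr_eq0.
Qed.

(* The digits of [x] are the coefficients [z_i] of the expansion
   [x_0 = z_0 + q z_1 + q ^ 2 z_2 + ...]; the tails [x_i] of the expansion are
   kept as coordinates, so that no q-adic integer has to be mentioned. *)
Definition digit (q : nat -> nat) (x : nat -> nat -> rat) k i :=
  x k i - (q k)%:R * x k i.+1.

Lemma digitB q x y k i : digit q (x - y) k i = digit q x k i - digit q y k i.
Proof.
have e j : (x - y) k j = x k j - y k j by [].
by rewrite /digit !e; ring.
Qed.

(** Row [k] describes an element of the factor at the prime [q k]. Digits are arbitrary integers
    rather than residues, so they add without carries. *)
Definition adic_pred (q : nat -> nat) : {pred nat -> nat -> rat} :=
  fun x => `[< forall k i,
    localized (q k) (x k i) /\ digit q x k i \is a Num.int >].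

Lemma adic_pred_zmod q : zmod_closed (adic_pred q).
Proof.
split=> [|x y /asboolP xq /asboolP yq]; apply/asboolP => k i.
  by rewrite /digit mulr0 subrr; split; [apply: localized_int|]; exact: rpred0.
have [[lx dx] [ly dy]] := (xq k i, yq k i); split; first by exact: localizedB.
by rewrite digitB rpredB.
Qed.

HB.instance Definition _ q :=
  GRing.isZmodClosed.Build _ (adic_pred q) (adic_pred_zmod q).

(* The field [R] is a phantom parameter: only the metric has values in it. *)
Record adic (R : realType) (q : nat -> nat) :=
  Adic { tails : nat -> nat -> rat; _ : tails \in adic_pred q }.

HB.instance Definition _ R q := [isSub for @tails R q].
HB.instance Definition _ R q := [Choice of adic R q by <:].
HB.instance Definition _ R q := [SubChoice_isSubZmodule of adic R q by <:].

(** * The metric and the group topology *)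

Section AdicMetric.
Variables (R : realType) (q : nat -> nat).
Local Notation G := (adic R q).
Implicit Types x y : G.

Lemma tails_inj : injective (@tails R q).
Proof. exact: val_inj. Qed.

Lemma tailsB x y k i : tails (x - y) k i = tails x k i - tails y k i.
Proof. by rewrite -[tails (x - y)]/(val (x - y)) raddfB. Qed.

Lemma tailsD x y k i : tails (x + y) k i = tails x k i + tails y k i.
Proof. by rewrite -[tails (x + y)]/(val (x + y)) raddfD. Qed.

Lemma tails0 k i : tails (0 : G) k i = 0.
Proof. by rewrite -[tails 0]/(val (0 : G)) raddf0. Qed.

Lemma tailsMz x m k i : tails (x *~ m) k i = m%:~R * tails x k i.
Proof.
have f_additive : {morph (fun y : G => tails y k i) : y z / y - z}.
  by move=> y z; exact: tailsB.
by rewrite -[LHS]/(additive_of f_additive (x *~ m)) raddfMz mulrzl.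
Qed.

Lemma adicP x k i :
  localized (q k) (tails x k i) /\ digit q (tails x) k i \is a Num.int.
Proof. by case: x => x /= /asboolP. Qed.

(** The basic neighbourhoods of 0. Tails may serve as coordinates because the tails of a row and its
    first tail together with its digits determine each other, finitely many at a time. *)
Definition vanish n : set G := [set x | forall k i, (k + i < n)%N -> tails x k i = 0].

Lemma vanish_subgroup n : subgroup (vanish n).
Proof.
split=> [k i _|x y xn yn k i kin]; first exact: tails0.
by rewrite tailsB xn // yn // subrr.
Qed.

Lemma vanish_le m n : (m <= n)%N -> vanish n `<=` vanish m.
Proof. by move=> mn x xn k i kim; apply: xn; exact: leq_trans mn. Qed.

Lemma vanish_eq0 x : (forall n, vanish n x) -> x = 0.
Proof.
move=> x0; apply: tails_inj; apply/funext => k; apply/funext => i.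
by rewrite (x0 (k + i).+1 k i) // tails0.
Qed.

(** Normalized so that the open ball of radius [n.+1%:R^-1] about 0 is exactly [vanish n]. *)
Definition adic_norm x : R :=
  match pselect (exists n, ~~ `[< vanish n x >]) with
  | left ex => (ex_minn ex).+1%:R^-1
  | right _ => 0
  end.

Lemma adic_norm_lt x n : adic_norm x < n.+1%:R^-1 <-> vanish n x.
Proof.
rewrite /adic_norm; case: pselect => [ex|nex].
  case: ex_minnP => m /asboolPn mx mmin; rewrite ltf_pV2 ?posrE // ltr_nat ltnS.
  split=> [nm|nx].
    by apply: contrapT => /asboolPn /mmin; rewrite leqNgt nm.
  by rewrite ltnNge; apply/negP => mn; apply: mx; exact: vanish_le nx.
split=> [_|_]; last by rewrite invr_gt0.
by apply: contrapT => /asboolPn nx; apply: nex; exists n.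
Qed.

Lemma adic_norm_eq0 x : adic_norm x = 0 -> x = 0.
Proof.
by move=> x0; apply: vanish_eq0 => n; apply/adic_norm_lt; rewrite x0 invr_gt0.
Qed.

Lemma adic_norm_ge0 x : 0 <= adic_norm x.
Proof. by rewrite /adic_norm; case: pselect => // ex; rewrite invr_ge0. Qed.

Lemma adic_norm0 : adic_norm 0 = 0.
Proof.
rewrite /adic_norm; case: pselect => // ex; case: ex_minnP => n /asboolPn n0 _; case: n0.
exact: (vanish_subgroup n).1.
Qed.

(** If [m] is the first level that [x - y] fails, then [x] or [y] fails it too, [vanish m] being a
    subgroup; so one of the two norms is already large enough. *)
Lemma adic_normB x y : adic_norm (x - y) <= adic_norm x + adic_norm y.
Proof.
rewrite {1}/adic_norm; case: pselect => [ex|_]; last by rewrite addr_ge0 ?adic_norm_ge0.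
case: ex_minnP => m /asboolPn mxy _.
have [xm|xm] := ltP (adic_norm x) m.+1%:R^-1; last first.
  by rewrite (le_trans xm) // lerDl adic_norm_ge0.
have [ym|ym] := ltP (adic_norm y) m.+1%:R^-1; last first.
  by rewrite (le_trans ym) // lerDr adic_norm_ge0.
by case: mxy; apply: (vanish_subgroup m).2; apply/adic_norm_lt.
Qed.

Definition adic_dist x y := adic_norm (x - y).

Lemma adic_distxx x : adic_dist x x = 0.
Proof. by rewrite /adic_dist subrr adic_norm0. Qed.

Lemma adic_dist_eq0 x y : adic_dist x y = 0 -> x = y.
Proof. by move/adic_norm_eq0/eqP; rewrite subr_eq0 => /eqP. Qed.

Lemma adic_dist_sym x y : adic_dist x y = adic_dist y x.
Proof.
suff le u v : adic_dist u v <= adic_dist v u by apply/eqP; rewrite eq_le !le.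
rewrite /adic_dist -[u - v]opprB -[- (v - u)]sub0r.
by apply: le_trans (adic_normB _ _) _; rewrite adic_norm0 add0r.
Qed.

Lemma adic_dist_triangle y x z : adic_dist x z <= adic_dist x y + adic_dist y z.
Proof.
rewrite [adic_dist y z]adic_dist_sym /adic_dist.
have -> : x - z = (x - y) - (z - y) by rewrite opprB addrA subrK.
exact: adic_normB.
Qed.

HB.instance Definition _ := isMetric.Build R G
  adic_distxx adic_dist_eq0 adic_dist_sym adic_dist_triangle.

Lemma adic_nbhsP x (V : set G) :
  nbhs x V <-> exists n, forall y, vanish n (x - y) -> V y.
Proof.
split=> [/nbhs_ballP[e /= e0 eV]|[n nV]].
  exists (Num.trunc e^-1) => y /adic_norm_lt xy; apply: eV.
  rewrite ballEmdist /=; apply: (lt_trans xy).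
  by rewrite invf_plt ?posrE // truncnS_gt.
apply/nbhs_ballP; exists (n.+1%:R^-1); first by rewrite /= invr_gt0.
by move=> y; rewrite ballEmdist /= => /adic_norm_lt /nV.
Qed.

Lemma adic_sub_continuous : continuous (fun x : G * G => x.1 - x.2).
Proof.
move=> [x1 x2] V /= /adic_nbhsP[n nV].
exists ([set y | vanish n (x1 - y)], [set y | vanish n (x2 - y)]).
  by split; apply/adic_nbhsP; exists n.
move=> [y1 y2] /= [xy1 xy2]; apply: nV.
rewrite (_ : _ - _ = (x1 - y1) - (x2 - y2)); last first.
  by rewrite !opprB [y2 - y1]addrC addrACA [- x2 + y2]addrC.
exact: (vanish_subgroup n).2.
Qed.

HB.instance Definition _ :=
  PreTopologicalNmodule_isTopologicalZmodule.Build G adic_sub_continuous.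

End AdicMetric.

(** * Polish and non-Archimedean properties *)

Section AdicPolish.
Variables (R : realType) (q : nat -> nat).
Local Notation G := (adic R q).

Lemma adic_non_archimedean : non_archimedean G.
Proof.
exists (@vanish R q); split=> [n|V /adic_nbhsP[n nV]]; last first.
  exists n => y yn; apply: nV; rewrite sub0r.
  by apply: (@subgroup_opp _ (vanish n)) => //; exact: vanish_subgroup.
split; last exact: vanish_subgroup.
rewrite openE => x xn; rewrite /interior /=; apply/adic_nbhsP; exists n => y xyn.
by rewrite -[y](subKr x); apply: (vanish_subgroup R q n).2.
Qed.

(** One element is picked for each finite table of rationals that occurs as a corner of some
    element. *)
Lemma adic_countable_dense : exists2 D : set G, countable D & dense D.
Proof.
pose trunc n (x : G) := [seq [seq tails x k i | i <- iota 0 n] | k <- iota 0 n].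
pose pick (p : nat * seq (seq rat)) : G := xget 0 [set x | trunc p.1 x = p.2].
exists (range pick); first exact: sub_countable (card_image_le _ _) (countableP _).
move=> O [x Ox] oO.
have /adic_nbhsP[n nO] : nbhs x O by apply: open_nbhs_nbhs.
exists (pick (n, trunc n x)); split; last by exists (n, trunc n x).
have pE : trunc n (pick (n, trunc n x)) = trunc n x.
  by apply: (xgetPex (0 : G) (P := [set x' | trunc n x' = trunc n x])); exists x.
apply: nO => k i kin.
have kn : (k < n)%N by exact: leq_ltn_trans (leq_addr _ _) kin.
have iN : (i < n)%N by exact: leq_ltn_trans (leq_addl _ _) kin.
have /(congr1 (fun t => nth 0 (nth [::] t k) i)) := pE.
rewrite !(nth_map 0%N) ?size_map ?size_iota // !nth_iota // !add0n => e.
by rewrite tailsB e subrr.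
Qed.

Lemma adic_complete : complete_uniform G.
Proof.
move=> F PF /cauchyP cF.
have cex n : exists x : G, F [set y | vanish n (x - y)].
  have [|x xF] := cF n.+1%:R^-1; first by rewrite invr_gt0.
  exists x; apply: filterS xF => y; rewrite ballEmdist /= => xy.
  by apply/adic_norm_lt.
have [c cP] := choice cex.
have c_eq m n k i : (k + i < m)%N -> (k + i < n)%N -> tails (c m) k i = tails (c n) k i.
  move=> kim kin; have [y [/= ym yn]] := filter_ex (filterI (cP m) (cP n)).
  have := ym k i kim; have := yn k i kin; rewrite !tailsB => /eqP + /eqP.
  by rewrite !subr_eq0 => /eqP-> /eqP->.
pose X k i := tails (c (k + i).+1) k i.
have XE n k i : (k + i < n)%N -> X k i = tails (c n) k i by move=> ?; exact: c_eq.
have Xq : X \in adic_pred q.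
  (* The digit at [(k, i)] also involves tail [i.+1], so it is read one level further than the
     tail. *)
  apply/asboolP => k i; have [lX dX] := adicP (c (k + i).+2) k i.
  by rewrite /digit !(XE (k + i).+2) ?addnS.
exists (Adic R Xq) => V /adic_nbhsP[n nV]; apply: filterS (cP n) => y yn.
apply: nV => k i kin; have := yn k i kin.
by rewrite !tailsB /= (XE n).
Qed.

Lemma adic_polish : polish R G.
Proof.
split; first exact: adic_countable_dense.
exists G, id; split; first exact: adic_complete.
by split=> [x|]; [exact: cvg_id|exists id; split=> // x; exact: cvg_id].
Qed.

End AdicPolish.

(** * Divisibility, and purity in a power of Z *)

(** If [a] is the numerator, divisibility by [p ^ |a|] forces [a = 0], because [|a| < p ^ |a|]. *)
Lemma localized_divisible p r : prime p -> localized p r ->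
  (forall e, exists2 s, localized p s & r = (p ^ e)%:R * s) -> r = 0.
Proof.
move=> pp [m cm /intrP[a ra]] rdiv.
have m0 : (m%:R : rat) != 0.
  by rewrite pnatr_eq0; apply: contraTneq cm => ->; rewrite /coprime gcdn0 neq_ltn prime_gt1 ?orbT.
suff a0 : a = 0 by apply/eqP; rewrite -(mulIr_eq0 _ (mulIf m0)) ra a0.
have [s [n cn /intrP[b sb]] rs] := rdiv `|a|%N.
have : (p ^ `|a| %| `|a| * n)%N.
  have e : a * n%:Z = (p ^ `|a|)%N%:Z * (b * m%:Z).
    apply: (@intr_inj rat); rewrite !rmorphM /= -ra -sb rs !pmulrn.
    by rewrite -!pmulrn; ring.
  by rewrite -[X in (_ * X)%N]absz_nat -abszM e abszM absz_nat dvdn_mulr.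
rewrite Gauss_dvdl ?coprimeXl // => /dvdn_leq leq_pa.
apply/eqP; rewrite -absz_eq0 -leqn0 leqNgt; apply/negP => /leq_pa.
by rewrite leqNgt ltn_expl ?prime_gt1.
Qed.

(** The exponent of [p] in [m] is at most [m]. *)
Lemma localized_expV p m : prime p -> (0 < m)%N ->
  localized p ((p ^ m)%:R / m%:R).
Proof.
move=> pp m0; have [m' cm] := pfactor_coprime pp m0; set e := logn p m => me.
exists m' => //.
have em : (e <= m)%N.
  apply: ltnW; apply: leq_trans (ltn_expl e (prime_gt1 pp)) _.
  by apply: dvdn_leq => //; rewrite [X in (_ %| X)%N]me dvdn_mull.
have m'0 : (m'%:R : rat) != 0.
  by rewrite pnatr_eq0; apply: contraTneq m0 => m'0; rewrite me m'0.
have p0 : ((p ^ e)%:R : rat) != 0 by rewrite pnatr_eq0 expn_eq0 negb_and -lt0n prime_gt0.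
rewrite (_ : _ * _ = (p ^ (m - e))%:R) ?rpred_nat //.
rewrite -{1}(subnK em) expnD [X in _ / X%:R]me !natrM invfM.
by rewrite mulrACA [_ * m'%:R]mulrC; field; rewrite m'0 p0.
Qed.

Section AdicAlgebra.
Variables (R : realType) (q : nat -> nat).
Hypothesis q_prime : forall k, prime (q k).
Local Notation G := (adic R q).
Implicit Types x y : G.

Definition digitz k i x : int := Num.floor (digit q (tails x) k i).

Lemma digitzE k i x : (digitz k i x)%:~R = digit q (tails x) k i.
Proof. by rewrite /digitz; apply: floorK; case: (adicP x k i). Qed.

Lemma digitzB k i : {morph digitz k i : x y / x - y}.
Proof.
move=> x y; apply: (@intr_inj rat); rewrite rmorphB /= !digitzE.
by rewrite /digit !tailsB; ring.
Qed.

Lemma digitzMz k i x m : digitz k i (x *~ m) = digitz k i x * m.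
Proof. by rewrite -mulrzz; exact: (raddfMz (additive_of (digitzB k i)) m x). Qed.

(** Purity of the digit embedding. A tail is a combination of [m] digits, all divisible by [m], plus
    [q k ^ m] times a later tail; the last term is divisible by [m] in the localization. So all
    tails can be divided by [m]. *)
Lemma adic_divisible x (m : nat) : (0 < m)%N ->
  (forall k i, (m%:Z %| digitz k i x)%Z) -> exists y, x = y *~ m.
Proof.
move=> m0 xm; have mR : (m%:R : rat) != 0 by rewrite pnatr_eq0 -lt0n.
have digit_int k i : digit q (tails x) k i / m%:R \is a Num.int.
  rewrite -digitzE; have /dvdzP[c ->] := xm k i.
  by rewrite rmorphM /= -pmulrn mulfK // intr_int.
have tail_int e k i : (tails x k i - (q k ^ e)%:R * tails x k (i + e)) / m%:R \is a Num.int.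
  elim: e => [|e IH]; first by rewrite expn0 mul1r addn0 subrr mul0r rpred0.
  rewrite (_ : _ / _ = (tails x k i - (q k ^ e)%:R * tails x k (i + e)) / m%:R +
    (q k ^ e)%:R * (digit q (tails x) k (i + e) / m%:R)).
    by rewrite rpredD // rpredM // rpred_nat.
  by rewrite /digit addnS expnSr natrM; ring.
pose Y k i := tails x k i / m%:R.
have Yq : Y \in adic_pred q.
  apply/asboolP => k i; split; last first.
    rewrite (_ : digit _ _ _ _ = digit q (tails x) k i / m%:R) //.
    by rewrite /digit /Y; ring.
  rewrite (_ : Y k i = (tails x k i - (q k ^ m)%:R * tails x k (i + m)) / m%:R +
    (q k ^ m)%:R / m%:R * tails x k (i + m)); last by rewrite /Y; ring.
  apply: localizedD; first exact: localized_int.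
  by apply: localizedM; [exact: localized_expV|case: (adicP x k (i + m))].
exists (Adic R Yq); apply: tails_inj; apply/funext => k; apply/funext => i.
by rewrite tailsMz /= /Y -pmulrn mulrC divfK.
Qed.

(** Such an [x] is divisible by every power of [q k], hence so are the tails of its row [k]. Thus
    the digits embed the group in a power of Z. *)
Lemma digitz_eq0 x : (forall k i, digitz k i x = 0) -> x = 0.
Proof.
move=> x0; apply: tails_inj; apply/funext => k; apply/funext => i; rewrite tails0.
apply: (localized_divisible (q_prime k)) => [|e]; first by case: (adicP x k i).
have [||y ->] := @adic_divisible x (q k ^ e).
- by rewrite expn_gt0 prime_gt0.
- by move=> k' i'; rewrite x0 dvdz0.
by rewrite tailsMz; exists (tails y k i) => //; case: (adicP y k i).
Qed.

(** The least positive value [n.+1] of a functional at [y] divides all values at [y], in particular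
    all digits of [y]. Purity then allows [y] to be divided by [n.+1]. *)
Lemma adic_unimodular y : y <> 0 ->
  exists (b : G) (m : int) (f : {additive G -> int}), y = b *~ m /\ f b = 1.
Proof.
move=> y0; pose P n := `[< exists f : {additive G -> int}, f y = n.+1%:Z >].
have Pf (f : {additive G -> int}) : f y != 0 -> P `|f y|%N.-1.
  move=> fy; apply/asboolP; rewrite prednK ?absz_gt0 //.
  have [fy0|fy0] := leP 0 (f y); first by exists f; rewrite gez0_abs.
  by exists (\- f); rewrite /= ltz0_abs.
have exP : exists n, P n.
  have [[k [i yki]]|ny] := pselect (exists k i, digitz k i y <> 0).
    by eexists; apply: (Pf (additive_of (digitzB k i))); exact/eqP.
  by case: y0; apply: digitz_eq0 => k i; apply: contrapT => yki; apply: ny; exists k, i.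
case: (ex_minnP exP) => n /asboolP[f fy] nmin.
have fdvd (g : {additive G -> int}) : (n.+1%:Z %| g y)%Z.
  pose c := (g y %/ n.+1%:Z)%Z.
  (* This functional takes the remainder of [g y] modulo [n.+1] as its value at [y], so minimality
     makes the remainder 0. *)
  have hB : {morph (fun x => g x - f x * c) : x x' / x - x'}.
    by move=> x x'; rewrite !raddfB /=; ring.
  have hy : additive_of hB y = (g y %% n.+1%:Z)%Z.
    by rewrite /= fy [X in X - _](divz_eq (g y) n.+1%:Z) -/c; ring.
  apply/dvdz_mod0P/eqP; apply: contraT => r0.
  have r_ge0 : 0 <= (g y %% n.+1%:Z)%Z by exact: modz_ge0.
  have r_lt : (g y %% n.+1%:Z)%Z < n.+1%:Z by exact: ltz_pmod.
  have := nmin _ (Pf (additive_of hB) _); rewrite hy => /(_ r0); lia.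
have [//||b yb] := @adic_divisible y n.+1.
  by move=> k i; exact: (fdvd (additive_of (digitzB k i))).
exists b, n.+1%:Z, f; split => //; move: fy; rewrite yb raddfMz mulrzz.
by rewrite -[RHS]mul1r => /mulIf; apply.
Qed.

End AdicAlgebra.

(** * Neighbourhoods in countable products of discrete spaces *)

Section DiscreteProduct.
Variable H : nat -> choiceType.
Local Notation P := (prod_topology (fun n => discrete_topology (H n))).

(** It suffices that the filter generated by the cylinders converges to [p], which is tested one
    coordinate at a time. *)
Lemma prod_discrete_nbhs (p : P) (V : set P) : nbhs p V ->
  exists N, forall y : P, (forall i, (i < N)%N -> y i = p i) -> V y.
Proof.
pose cylinder N := [set y : P | forall i, (i < N)%N -> y i = p i].
have cylinder_filter : Filter (filter_from [set: nat] cylinder).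
  apply: filter_from_filter; first by exists 0%N.
  move=> i j _ _; exists (maxn i j) => // y yij.
  by split=> k kl; apply: yij; rewrite leq_max kl ?orbT.
suff cvg_p : filter_from [set: nat] cylinder --> p by move=> /cvg_p[N _ NV]; exists N.
apply/cvg_sup => i W.
have /= -> := @nbhsE (initial_topology (fun f : P => f i)) p.
case=> B [[C oC <-] Cp] BW; exists i.+1 => // y yp.
by apply: BW; rewrite /preimage /= yp.
Qed.

Lemma prod_discrete_coord (p : P) i : nbhs p [set y : P | y i = p i].
Proof.
pose T n : topologicalType := discrete_topology (H n).
exact: (@proj_continuous _ T i p _ (discrete_set1 (p i : discrete_topology (H i)))).
Qed.

Lemma prod_discrete_cylinder (p : P) N :
  nbhs p [set y : P | forall i, (i < N)%N -> y i = p i].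
Proof.
elim: N => [|N IH]; first by apply: filterS (@filterT _ (nbhs p) _) => y _ i.
apply: filterS (filterI IH (prod_discrete_coord p N)) => y [yN yN'] i.
by rewrite ltnS leq_eqVlt => /predU1P[->|/yN].
Qed.

End DiscreteProduct.

(** * Elements with prescribed tails; exclusion of product groups *)

Section AdicElements.
Variables (R : realType) (q : nat -> nat).
Hypothesis q_prime : forall k, prime (q k).
Local Notation G := (adic R q).
Implicit Types x y : G.

(* For [N = 0] the sequence [(- d) ^ i r] is a tail sequence of [r] because
   [r + q d r] is an integer. *)
Lemma exists_adic_geometric N (d : nat -> nat) (r : nat -> rat) :
  (forall k, localized (q k) (r k)) ->
  (forall k, (1 + (q k)%:R * (d k)%:R) * r k \is a Num.int) ->
  exists x : G, forall k i,
    tails x k i = (q k)%:R ^+ (N - i) * (- (d k)%:R) ^+ (i - N) * r k.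
Proof.
move=> lr dr.
pose X k i : rat := (q k)%:R ^+ (N - i) * (- (d k)%:R) ^+ (i - N) * r k.
suff Xq : X \in adic_pred q by exists (Adic R Xq).
apply/asboolP => k i; split.
  by apply: localizedM => //; apply: localized_int; rewrite rpredM // rpredX // ?rpredN rpred_nat.
rewrite /digit /X; have [iN|Ni] := ltnP i N.
  rewrite -(subnSK iN) exprS.
  have -> : (i - N = 0)%N by lia.
  have -> : (i.+1 - N = 0)%N by lia.
  by rewrite !expr0 !mulr1 mulrA subrr rpred0.
have -> : (N - i = 0)%N by lia.
have -> : (N - i.+1 = 0)%N by lia.
rewrite subSn // exprS !expr0.
rewrite (_ : _ - _ = (- (d k)%:R) ^+ (i - N) * ((1 + (q k)%:R * (d k)%:R) * r k)); last by ring.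
by rewrite rpredM // rpredX // rpredN rpred_nat.
Qed.

(** In row [k] the first [N] digits are 0 and tail [N] is an arbitrary element [r k] of the
    localization. *)
Lemma exists_adic_tails N (r : nat -> rat) : (forall k, localized (q k) (r k)) ->
  exists x : G, forall k i, (i <= N)%N -> tails x k i = (q k)%:R ^+ (N - i) * r k.
Proof.
move=> lr.
have dex k : exists d : nat, (1 + (q k)%:R * d%:R) * r k \is a Num.int.
  have [M cM rM] := lr k.
  have M0 : (0 < M)%N.
    by case: M cM {rM} => //; rewrite /coprime gcdn0 => /eqP qk; have := q_prime k; rewrite qk.
  (* Bezout gives [c * M = d * q k + 1], where [M] clears the denominator of [r k]. *)
  case: (egcdnP (q k) M0) => c d; rewrite gcdnC (eqP cM) => e _.
  exists d; rewrite (_ : _ * _ = c%:R * (r k * M%:R)); first by rewrite rpredM // rpred_nat.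
  have eR : c%:R * M%:R = d%:R * (q k)%:R + 1 :> rat by rewrite -natrM e natrD natrM.
  by rewrite mulrCA eR; ring.
have [d dP] := choice dex.
have [x xE] := exists_adic_geometric N lr dP.
exists x => k i iN; rewrite xE.
have -> : (i - N = 0)%N by lia.
by rewrite expr0 mulr1.
Qed.

(** The element whose only nonzero digit is a 1 at place [N] of row [k]; taking [d = 0] ends the
    expansion there. *)
Lemma exists_adic_unit k N : exists x : G, forall k' i,
  tails x k' i = if (k' == k) && (i <= N)%N then (q k)%:R ^+ (N - i) else 0.
Proof.
have [||x xE] := @exists_adic_geometric N (fun=> 0%N) (fun k' => (k' == k)%:R).
- by move=> k'; apply: localized_int; rewrite rpred_nat.
- by move=> k'; rewrite mulr0 addr0 mul1r rpred_nat.
exists x => k' i; rewrite xE oppr0 expr0n subn_eq0.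
case: eqVneq => [->|_] /=; last by rewrite mulr0.
by case: leqP => _; rewrite !mulr1 ?mulr0.
Qed.

Lemma tails_digits0 x k i e :
  (forall j, (i <= j < i + e)%N -> digitz k j x = 0) ->
  tails x k i = (q k)%:R ^+ e * tails x k (i + e).
Proof.
elim: e => [|e IH] x0; first by rewrite expr0 mul1r addn0.
rewrite IH => [|j /andP[ij je]]; last by apply: x0; rewrite ij addnS leqW.
have /(congr1 (fun z : int => z%:~R : rat)) : digitz k (i + e) x = 0.
  by apply: x0; rewrite leq_addr addnS leqnn.
rewrite digitzE /digit => /eqP; rewrite subr_eq0 => /eqP ->.
by rewrite exprSr addnS mulrA.
Qed.

(** [r] is the projection to the first [N] factors, carried back to the group. It kills some
    [vanish n] and moves elements only by [vanish 1]. The unit digit at place [n] of row 0 is killed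
    by [r], yet its first tail [q 0 ^ n] is not 0. *)
Lemma adic_not_product : ~ iso_to_product_group G.
Proof.
case=> H [phi [_ phiD [phi_cont [psi [psi_cont phiK psiK]]]]].
have phi0 n : phi 0 n = 1%g :> H n.
  by apply: (@mulgI _ (phi 0 n : H n)); rewrite -phiD addr0 mulg1.
have psi1 : psi (phi 0) = 0 := phiK 0.
have W0 : nbhs (psi (phi 0)) (vanish 1 : set G).
  rewrite psi1; apply/adic_nbhsP; exists 1%N => y.
  by rewrite sub0r => /(subgroup_opp (vanish_subgroup R q 1)); rewrite opprK.
have [N NW] := prod_discrete_nbhs (psi_cont _ _ W0).
pose head x : prod_topology (fun n => discrete_topology (H n)) :=
  fun n => if (n < N)%N then phi x n else 1%g.
pose r x := psi (head x).
have phir x n : phi (r x) n = head x n by rewrite /r psiK.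
have phi_inj x y : (forall n, phi x n = phi y n) -> x = y.
  by move=> e; apply: (can_inj phiK); exact: functional_extensionality_dep.
have rD x y : r (x + y) = r x + r y.
  apply: phi_inj => n; rewrite phiD !phir /head.
  by case: ifP => _; [exact: phiD|rewrite mulg1].
have r0 : r 0 = 0 by apply: (addIr (r 0)); rewrite add0r -rD addr0.
have rB : {morph r : x y / x - y}.
  by move=> x y; apply: (addIr (r y)); rewrite -rD !subrK.
have rW x : vanish 1 (x - r x).
  rewrite -[x - r x]phiK; apply: NW => i iN.
  have := phiD (x - r x) (r x) i; rewrite subrK phir /head iN.
  by rewrite phi0 -{1}[phi x i](mul1g (phi x i : H i)) => /mulIg.
have [n nker] : exists n, forall x, vanish n x -> r x = 0.
  have /adic_nbhsP[n nV] := phi_cont 0 _ (prod_discrete_cylinder (phi 0) N).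
  exists n => x xn; apply: phi_inj => i; rewrite phir /head phi0.
  case: ifP => // iN; rewrite -(phi0 i); apply: nV iN.
  by rewrite sub0r; exact: subgroup_opp (vanish_subgroup R q n) xn.
have [x xE] := exists_adic_unit 0 n.
(* Modulo [vanish n], [x] is [m] times the element with tail [m%:R^-1] at place [n] of row 0, and
   [r] kills the difference. *)
have rdiv m : coprime (q 0) m -> (0 < m)%N -> exists y, r x = r y *~ m.
  move=> cm m0; have [|y yE] := @exists_adic_tails n (fun k => if k == 0%N then m%:R^-1 else 0).
    by case=> [|k] /=; [exact: localizedV|apply: localized_int; exact: rpred0].
  exists y; rewrite -[RHS](raddfMz (additive_of rB)) /=; apply/eqP.
  rewrite -subr_eq0 -rB; apply/eqP; apply: nker => k i kin.
  have iN : (i <= n)%N by lia.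
  rewrite tailsB tailsMz xE yE // iN andbT; case: eqVneq => [->|_]; last by rewrite !mulr0 subrr.
  by rewrite mulrCA -pmulrn divff ?mulr1 ?subrr // pnatr_eq0 -lt0n.
have rx0 : r x = 0.
  apply: (digitz_eq0 q_prime) => k i; apply/eqP; rewrite -absz_eq0.
  (* This number is prime to [q 0] and exceeds the absolute value of the digit it must divide. *)
  pose m := (q 0 * `|digitz k i (r x)|).+1.
  have cm : coprime (q 0) m.
    by rewrite /m -addn1 mulnC /coprime gcdnMDl gcdn1.
  have [//|y rxy] := rdiv m cm.
  have : (m %| `|digitz k i (r x)|)%N.
    rewrite -[m]absz_nat -dvdzE; apply/dvdzP; exists (digitz k i (r y)).
    by rewrite {1}rxy digitzMz.
  apply: contraTT; rewrite -lt0n => x_gt0; rewrite gtnNdvd // ltnS.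
  by rewrite leq_pmull // prime_gt0.
have := rW x; rewrite rx0 subr0 => /(_ 0 0 isT)%N; rewrite xE /= subn0 => /eqP.
by rewrite expf_eq0 pnatr_eq0 eqn0Ngt (prime_gt0 (q_prime 0)) andbF.
Qed.

End AdicElements.

(** * Nonexistence of continuous surjections *)

Section NoSurjection.
Variables (R : realType) (q q' : nat -> nat).
Hypothesis q_prime : forall k, prime (q k).
Hypothesis q'_prime : forall k, prime (q' k).

(** [g], the first tail of row [n] of [f x], takes values in the localization at [q' n]. These
    values turn out to have a common denominator, whereas the first tails of row [n] in the target
    have none. *)
Lemma adic_no_surjection n : (forall k, q k != q' n) ->
  forall f : {additive adic R q -> adic R q'},
    continuous f -> ~ (forall y, exists x, f x = y).
Proof.
move=> qq' f f_cont f_surj.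
have gB : {morph (fun x => tails (f x) n 0) : x y / x - y}.
  by move=> x y; rewrite raddfB tailsB.
pose g := additive_of gB.
have g_loc x : localized (q' n) (g x) by case: (adicP (f x) n 0).
have [N gN] : exists N, forall x, vanish N x -> g x = 0.
  have V0 : nbhs (f 0) (vanish n.+1 : set (adic R q')).
    rewrite raddf0; apply/adic_nbhsP; exists n.+1 => y.
    by rewrite sub0r => /(subgroup_opp (vanish_subgroup R q' n.+1)); rewrite opprK.
  have /adic_nbhsP[N NV] := f_cont 0 _ V0.
  exists N => x xN; apply: (NV x _ n 0%N); last by rewrite addn0.
  by rewrite sub0r; exact: subgroup_opp (vanish_subgroup R q N) xN.
pose pairs := [seq (k, i) | k <- iota 0 N, i <- iota 0 N].
pose digits_in (L : seq (nat * nat)) (x : adic R q) :=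
  forall k i, (k, i) \in pairs -> (k, i) \notin L -> digitz k i x = 0.
have pairsP k i : ((k, i) \in pairs) = (k < N)%N && (i < N)%N.
  apply/allpairsP/andP => [[[k' i'] /= [+ + [-> ->]]]|[kN iN]].
    by rewrite !mem_iota.
  by exists (k, i); rewrite !mem_iota.
(* If the digits in the [N] by [N] square vanish, [x] is [q' n ^ e] times some [y] modulo
   [vanish N]: tail [N] of each row [k < N] can be divided, as [q' n] differs from [q k]. So [g x]
   is divisible by all powers of [q' n]. *)
have g0 x : digits_in [::] x -> g x = 0.
  move=> x0; apply: (localized_divisible (q'_prime n)) => // e.
  have [|y yE] := @exists_adic_tails R q q_prime N
      (fun k => if (k < N)%N then tails x k N / (q' n ^ e)%:R else 0).
    move=> k; case: ifP => _; last by apply: localized_int; exact: rpred0.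
    apply: localizedM; first by case: (adicP x k N).
    by apply: localizedV; rewrite coprimeXr // prime_coprime // dvdn_prime2.
  exists (g y) => //; apply/eqP; rewrite -subr_eq0; apply/eqP.
  have t0 : ((q' n ^ e)%:R : rat) != 0 by rewrite pnatr_eq0 -lt0n expn_gt0 prime_gt0.
  have -> : g x - (q' n ^ e)%:R * g y = g (x - y *~ (q' n ^ e)%N).
    by rewrite raddfB raddfMz pmulrn mulrzl.
  apply: gN => k i kin; have kN : (k < N)%N by lia.
  have iN : (i <= N)%N by lia.
  rewrite tailsB tailsMz yE // kN -pmulrn (@tails_digits0 R q x k i (N - i)).
    rewrite subnKC //; set t := (q' n ^ e)%:R in t0 *.
    have tK : t * (tails x k N / t) = tails x k N by rewrite mulrC divfK.
    by rewrite mulrCA tK subrr.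
  move=> j; rewrite subnKC // => /andP[_ jN]; apply: x0 => //.
  by rewrite pairsP kN jN.
(* Induction on the list of positions where digits may be nonzero: subtracting a multiple of the
   unit [u] clears one digit, at the cost of the denominator of [g u]. *)
have bounded (L : seq (nat * nat)) : exists2 M : nat, (0 < M)%N &
    forall x, digits_in L x -> M%:R * g x \is a Num.int.
  elim: L => [|[k i] L [M M0 MP]].
    by exists 1%N => // x /g0->; rewrite mulr0 rpred0.
  have [u uE] := exists_adic_unit R q k i.
  have [m _ mu] := g_loc u.
  have [m' m'0 m'u] : exists2 m' : nat, (0 < m')%N & m'%:R * g u \is a Num.int.
    exists `|denq (g u)|%N; first by rewrite absz_gt0 denq_neq0.
    by rewrite natr_absz gtr0_norm ?denq_gt0 // mulrC -numqE intr_int.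
  exists (M * m')%N => [|x xL]; first by rewrite muln_gt0 M0.
  rewrite -(subrK (u *~ digitz k i x) x) raddfD mulrDr rpredD //; last first.
    rewrite raddfMz -mulrzl mulrCA natrM -mulrA; apply: rpredM; first exact: intr_int.
    by apply: rpredM => //; exact: rpred_nat.
  rewrite mulnC natrM -mulrA; apply: rpredM; first exact: rpred_nat.
  apply: MP => k' i' ki kiL.
  have ud : digitz k' i' u = ((k' == k) && (i' == i))%:R.
    apply: (@intr_inj rat); rewrite digitzE /digit !uE.
    case: eqVneq => [->|_] /=; last by rewrite mulr0 subrr.
    case: (ltngtP i' i) => [ii|ii|->].
    - by rewrite -(subnSK ii) exprS subrr.
    - by rewrite mulr0 subrr.
    - by rewrite subnn mulr0 subr0.
  rewrite digitzB digitzMz ud.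
  have [[-> ->]|ne] := eqVneq (k', i') (k, i).
    by rewrite !eqxx mul1r subrr.
  rewrite xL ?inE ?negb_or ?ne // -[(_ && _)]/((k', i') == (k, i)).
  by rewrite (negbTE ne) mul0r subrr.
have [M M0 MP] := bounded pairs.
(* The denominator [(q' n * M).+1] is prime to [q' n] and too large to divide [M]. *)
have [|y yE] := @exists_adic_tails R q' q'_prime 0
    (fun k => if k == n then (q' n * M).+1%:R^-1 else 0).
  move=> k; case: eqP => [->|_]; last by apply: localized_int; exact: rpred0.
  by apply: localizedV; rewrite -addn1 mulnC /coprime gcdnMDl gcdn1.
have [x fx] := f_surj y.
have : M%:R * g x \is a Num.int by apply: MP => k i ->.
rewrite /g /= fx yE // eqxx mul1r => /intrP[c].
move/(canRL (divfK _)); rewrite pnatr_eq0 => /(_ isT) e.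
have {}e : M%:Z = c * (q' n * M).+1%:Z.
  by apply: (@intr_inj rat); rewrite rmorphM /= -!pmulrn e.
have : ((q' n * M).+1 %| M)%N.
  by rewrite -[X in (X %| _)%N]absz_nat -[M in (_ %| M)%N]absz_nat -dvdzE e dvdz_mull.
move/dvdn_leq => /(_ M0); rewrite leqNgt ltnS leq_pmull // prime_gt0 //.
Qed.

End NoSurjection.

(** * The completely decomposable stages *)

(** Stage [n] records digits inside the triangle [k + i < n], the remaining tail of each row on the
    antidiagonal, and nothing beyond. *)
Definition slot (q : nat -> nat) (n k i : nat) (r : rat) : Prop :=
  if (k + i < n)%N then (r \is a Num.int : Prop)
  else if (k + i == n)%N then localized (q k) r else r = 0.

Lemma slot_int q n k i : (k + i <= n)%N -> forall r, r \is a Num.int -> slot q n k i r.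
Proof.
rewrite /slot leq_eqVlt => /predU1P[->|->] // r ri.
by rewrite ltnn eqxx; exact: localized_int.
Qed.

Lemma slot0 q n k i : slot q n k i 0.
Proof.
rewrite /slot; case: ifP => _; first exact: rpred0.
by case: ifP => // _; apply: localized_int; exact: rpred0.
Qed.

Lemma slotB q n k i r s : slot q n k i r -> slot q n k i s -> slot q n k i (r - s).
Proof.
rewrite /slot; case: ifP => _; first exact: rpredB.
by case: ifP => _; [exact: localizedB|move=> -> ->; rewrite subrr].
Qed.

Definition stage_pred (q : nat -> nat) n : {pred nat -> nat -> rat} :=
  fun c => `[< forall k i, slot q n k i (c k i) >].

Lemma stage_pred_zmod q n : zmod_closed (stage_pred q n).
Proof.
split=> [|c d /asboolP cq /asboolP dq]; apply/asboolP => k i; first exact: slot0.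
exact: slotB.
Qed.

HB.instance Definition _ q n :=
  GRing.isZmodClosed.Build _ (stage_pred q n) (stage_pred_zmod q n).

Record stage (q : nat -> nat) (n : nat) :=
  Stage { entry : nat -> nat -> rat; _ : entry \in stage_pred q n }.

HB.instance Definition _ q n := [isSub for @entry q n].
HB.instance Definition _ q n := [Choice of stage q n by <:].
HB.instance Definition _ q n := [SubChoice_isSubZmodule of stage q n by <:].

Section Stage.
Variables (q : nat -> nat) (n : nat).
Local Notation A := (stage q n).
Implicit Types c d : A.

Lemma stage_eq c d : (forall k i, entry c k i = entry d k i) -> c = d.
Proof.
by move=> e; apply: val_inj; apply/funext => k; apply/funext => i; exact: e.
Qed.

Lemma entryP c k i : slot q n k i (entry c k i).
Proof. by case: c => c /= /asboolP. Qed.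

Lemma entry_out c k i : (n < k + i)%N -> entry c k i = 0.
Proof.
move=> nki; have := entryP c k i.
by rewrite /slot ltnNge (ltnW nki) /= gtn_eqF.
Qed.

Lemma entryB k i : {morph (fun c => entry c k i) : c d / c - d}.
Proof. by move=> c d; rewrite -[LHS]/(val (c - d) k i) raddfB. Qed.

Definition entry_additive k i : {additive A -> rat} := additive_of (entryB k i).

Lemma stage_torsion_free : torsion_free A.
Proof.
move=> c m cm; apply: stage_eq => k i.
have := congr1 (entry_additive k i) cm; rewrite raddfMn raddf0 => /eqP.
by rewrite mulrn_eq0 /= => /eqP->; rewrite -[RHS](raddf0 (entry_additive k i)).
Qed.

Lemma stage_countable : countable [set: A].
Proof.
pose table c := [ffun p : 'I_n.+1 * 'I_n.+1 => entry c p.1 p.2].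
apply/countable_injP; exists (fun c => choice.pickle (table c)) => c d _ _.
move=> /(pcan_inj choice.pickleK) /ffunP cd; apply: stage_eq => k i.
have [ki|ki] := leqP (k + i) n; last by rewrite !entry_out.
have kn : (k < n.+1)%N by rewrite ltnS (leq_trans _ ki) ?leq_addr.
have iN : (i < n.+1)%N by rewrite ltnS (leq_trans _ ki) ?leq_addl.
by have := cd (Ordinal kn, Ordinal iN); rewrite !ffunE.
Qed.

Lemma exists_single k i r : (k + i <= n)%N -> slot q n k i r ->
  exists c : A, forall k' i', entry c k' i' = if (k', i') == (k, i) then r else 0.
Proof.
move=> ki kir; pose X k' i' := if (k', i') == (k, i) then r else 0.
have Xq : X \in stage_pred q n.
  apply/asboolP => k' i'; rewrite /X.
  by case: eqP => [[-> ->] //|_]; exact: slot0.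
by exists (Stage Xq).
Qed.

Definition index := {p : 'I_n.+1 * 'I_n.+1 | (p.1 + p.2 <= n)%N}.

Definition index_pair (p : index) : nat * nat := (nat_of_ord (val p).1, nat_of_ord (val p).2).

Lemma index_pair_inj : injective index_pair.
Proof. by move=> [[a b] ab] [[c d] cd] [/val_inj e /val_inj f]; apply: val_inj; rewrite /= e f. Qed.

Lemma index_pair_surj k i : (k + i <= n)%N -> exists p, index_pair p = (k, i).
Proof.
move=> ki.
have kn : (k < n.+1)%N by rewrite ltnS (leq_trans _ ki) ?leq_addr.
have iN : (i < n.+1)%N by rewrite ltnS (leq_trans _ ki) ?leq_addl.
by exists (exist _ (Ordinal kn, Ordinal iN) ki).
Qed.

Definition component (p : index) : set A :=
  [set c | forall k i, (k, i) != index_pair p -> entry c k i = 0].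

Lemma component_subgroup p : subgroup (component p).
Proof.
split=> [k i _|c d cp dp k i kip]; first by rewrite -[LHS]/(entry_additive k i 0) raddf0.
by rewrite entryB cp // dp // subrr.
Qed.

Lemma component_eq0 p c : component p c ->
  entry c (index_pair p).1 (index_pair p).2 = 0 -> c = 0.
Proof.
move=> cp c0; apply: stage_eq => k i; rewrite -[RHS]/(entry_additive k i 0) raddf0.
have [kip|/cp //] := eqVneq (k, i) (index_pair p).
by move: c0; rewrite -kip.
Qed.

Lemma stage_direct_sum : internal_direct_sum component.
Proof.
split; first exact: component_subgroup.
- move=> c.
  have bex p : exists b : A, forall k i,
      entry b k i = if (k, i) == index_pair p then entry c k i else 0.
    have [b bE] := exists_single (valP p) (entryP c (val p).1 (val p).2).
    by exists b => k i; rewrite bE -/(index_pair p); case: eqP => [[-> ->]|].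
  have [b bE] := choice bex.
  exists (index_enum index), b; split=> [p k i /negbTE kip|]; first by rewrite bE kip.
  apply: stage_eq => k i; rewrite -[RHS]/(entry_additive k i _) raddf_sum /=.
  have [ki|ki] := leqP (k + i) n; last first.
    rewrite entry_out // big1 // => p _; rewrite bE entry_out //.
    by case: ifP.
  have [p pE] := index_pair_surj ki.
  rewrite (bigD1 p) //= bE pE eqxx big1 ?addr0 // => p' pp'.
  by rewrite bE -pE (inj_eq index_pair_inj) eq_sym (negbTE pp').
- move=> s b us bs s0 p ps; apply: (component_eq0 (bs p)).
  have := congr1 (entry_additive (index_pair p).1 (index_pair p).2) s0.
  rewrite raddf0 raddf_sum (bigD1_seq p) //= big1_seq ?addr0 // => p' /andP[pp' _].
  by apply: bs; rewrite -[X in X != _]/(index_pair p) (inj_eq index_pair_inj) eq_sym.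
Qed.

(** With [a] of entry 1 and [s] of entry [r] at [p], the relation [s *~ denq r = a *~ numq r] keeps
    [s] out of every independent set that contains [a], unless [s = a]. *)
Lemma component_rank_one p : rank_one (component p).
Proof.
have [a aE] := exists_single (valP p) (slot_int q (valP p) (rpred1 _)).
have aE1 : entry a (index_pair p).1 (index_pair p).2 = 1 by rewrite aE eqxx.
have E0 (c : A) (m : int) k i : entry (c *~ m) k i = m%:~R * entry c k i.
  by rewrite -[LHS]/(entry_additive k i _) raddfMz mulrzl.
exists a; split.
- by move=> k i /negbTE kip; rewrite aE kip.
- move=> s c us sa s0 b bs; have ba : b = a := sa b bs.
  have := s0; rewrite (bigD1_seq b) //= big1_seq ?addr0; last first.
    by move=> x /andP[xb /sa /= xa]; rewrite xa ba eqxx in xb.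
  move/(congr1 (fun x => entry x (index_pair p).1 (index_pair p).2)).
  rewrite E0 ba aE1 mulr1 -[RHS]/(entry_additive _ _ 0) raddf0 => /eqP.
  by rewrite intr_eq0 => /eqP.
- move=> S Sp Si aS; apply/seteqP; split=> [s Ss|//].
  apply: contrapT => /eqP sa.
  pose r := entry s (index_pair p).1 (index_pair p).2.
  pose c (x : A) := if x == a then - numq r else denq r.
  suff : c s = 0 by rewrite /c (negbTE sa) => /eqP; rewrite (negbTE (denq_neq0 r)).
  apply: (Si [:: s; a]); rewrite ?inE ?eqxx //=.
  + by rewrite inE sa.
  + by move=> x /=; rewrite !inE => /orP[/eqP-> //|/eqP->]; by apply: aS.
  rewrite big_cons big_seq1 /c (negbTE sa) eqxx.
  apply: (@component_eq0 p).
    have cS := component_subgroup p; apply: (subgroup_add cS).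
      by apply: (subgroup_mulz _ cS); exact: Sp.
    by apply: (subgroup_mulz _ cS); apply: Sp; exact: aS.
  rewrite -[LHS]/(entry_additive _ _ (s *~ _ + _)) raddfD /= !E0 aE1 mulr1 -/r rmorphN /=.
  by rewrite numqE mulrC subrr.
Qed.

Lemma stage_completely_decomposable : completely_decomposable A.
Proof.
split; first exact: stage_torsion_free.
exists index, component; split; [exact: stage_direct_sum|exact: component_rank_one].
Qed.

End Stage.

(** * The group as an inverse limit of the stages *)

Section AdicInverseLimit.
Variables (R : realType) (q : nat -> nat).
Local Notation G := (adic R q).

(** On the antidiagonal the last digit and the tail after it are merged into one tail, by
    [x_i = z_i + q x_(i+1)]. *)
Definition stage_map_fun n (c : nat -> nat -> rat) k i : rat :=
  if (k + i < n)%N then c k i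
  else if (k + i == n)%N then c k i + (q k)%:R * c k i.+1 else 0.

Lemma stage_map_subproof n (c : stage q n.+1) :
  stage_map_fun n (entry c) \in stage_pred q n.
Proof.
apply/asboolP => k i; rewrite /slot /stage_map_fun.
have := entryP c k i.+1; have := entryP c k i; rewrite /slot addnS.
case: (ltngtP (k + i) n) => //= kin; first by rewrite ltnS (ltnW kin).
rewrite kin ltnSn ltnn eqxx => ci lc; apply: localizedD; first exact: localized_int.
by apply: localizedM => //; apply: localized_int; exact: rpred_nat.
Qed.

Definition stage_map n (c : stage q n.+1) : stage q n := Stage (stage_map_subproof c).

Lemma stage_mapB n : {morph @stage_map n : c d / c - d}.
Proof.
move=> c d; apply: stage_eq => k i; rewrite (entryB k i).
rewrite -[LHS]/(stage_map_fun n (entry (c - d)) k i) /stage_map_fun.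
rewrite (entryB k i) (entryB k i.+1) /= /stage_map_fun.
by case: ifP => // _; case: ifP => _; ring.
Qed.

Definition transition n : {additive stage q n.+1 -> stage q n} := additive_of (@stage_mapB n).

Definition truncate_fun n (x : G) k i : rat :=
  if (k + i < n)%N then digit q (tails x) k i
  else if (k + i == n)%N then tails x k i else 0.

Lemma truncate_subproof n x : truncate_fun n x \in stage_pred q n.
Proof.
apply/asboolP => k i; have [lx dx] := adicP x k i.
by rewrite /slot /truncate_fun; case: ltngtP.
Qed.

Definition truncate n x : stage q n := Stage (truncate_subproof n x).

Lemma truncateD n x y : truncate n (x + y) = truncate n x + truncate n y.
Proof.
apply: stage_eq => k i; rewrite -[RHS]/(entry_additive q n k i _) raddfD.
rewrite -[LHS]/(truncate_fun n (x + y) k i) /= /truncate_fun /digit !tailsD.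
by case: ifP => _; [ring|case: ifP => // _; rewrite addr0].
Qed.

Lemma transition_truncate n x : transition n (truncate n.+1 x) = truncate n x.
Proof.
apply: stage_eq => k i; rewrite /= /stage_map_fun /truncate_fun addnS.
case: (ltngtP (k + i) n) => //= kin; first by rewrite ltnS (ltnW kin).
by rewrite kin ltnSn ltnn eqxx /digit subrK.
Qed.

(** The level is [n.+1] because stage [n] involves the tails on the antidiagonal [k + i = n]. *)
Lemma truncate_eq n x y : vanish n.+1 (x - y) -> truncate n x = truncate n y.
Proof.
move=> xy; have xyE k i : (k + i <= n)%N -> tails x k i = tails y k i.
  by move=> kin; have := xy k i kin; rewrite tailsB => /eqP; rewrite subr_eq0 => /eqP.
apply: stage_eq => k i; rewrite /= /truncate_fun /digit.
case: ltngtP => // kin; rewrite !xyE ?addnS //; [exact: ltnW|by rewrite kin].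
Qed.

Lemma truncate_inverse_limit x : (fun n => truncate n x) \in inverse_limit transition.
Proof. by apply/mem_set => n; exact: transition_truncate. Qed.

Definition to_limit (x : G) : inverse_limit transition :=
  exist _ (fun n => truncate n x) (truncate_inverse_limit x).

Section FromLimit.
Variable y : inverse_limit transition.
Let c n : stage q n := set_val y n.

Lemma limit_transition n : transition n (c n.+1) = c n.
Proof. exact: (set_valP y n). Qed.

Lemma limit_entry_stable n k i : (k + i < n)%N ->
  entry (c n) k i = entry (c (k + i).+1%N) k i.
Proof.
elim: n => // n IH; rewrite ltnS leq_eqVlt => /predU1P[<- //|kin].
by rewrite -IH // -(limit_transition n) /= /stage_map_fun kin.
Qed.

(** Stage [k + i] is the one whose antidiagonal holds the tail at [(k, i)]; all later stages hold
    the digit there. *)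
Definition limit_tails k i : rat := entry (c (k + i)%N) k i.

Lemma digit_limit k i : digit q limit_tails k i = entry (c (k + i).+1%N) k i.
Proof.
rewrite /digit /limit_tails addnS -[c (k + i)%N]limit_transition /= /stage_map_fun.
by rewrite ltnn eqxx addrK.
Qed.

Lemma from_limit_subproof : limit_tails \in adic_pred q.
Proof.
apply/asboolP => k i; split.
  by have := entryP (c (k + i)%N) k i; rewrite /slot ltnn eqxx.
by rewrite digit_limit; have := entryP (c (k + i).+1%N) k i; rewrite /slot ltnSn.
Qed.

Definition from_limit : G := Adic R from_limit_subproof.

Lemma truncate_from_limit n : truncate n from_limit = c n.
Proof.
apply: stage_eq => k i; rewrite /= /truncate_fun digit_limit.
case: ltngtP => kin; first by rewrite (limit_entry_stable kin).
  by rewrite entry_out.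
by rewrite -kin.
Qed.

End FromLimit.

Lemma to_limitK : cancel to_limit from_limit.
Proof.
move=> x; apply: tails_inj; apply/funext => k; apply/funext => i.
by rewrite /= /limit_tails /= /truncate_fun ltnn eqxx.
Qed.

Lemma from_limitK : cancel from_limit to_limit.
Proof.
move=> y; apply: val_inj; apply: functional_extensionality_dep => n.
exact: truncate_from_limit.
Qed.

Lemma to_limit_continuous : continuous to_limit.
Proof.
move=> x V; rewrite nbhsE => -[_ [[C oC <-] Cx] CV].
have [N NC] := prod_discrete_nbhs (open_nbhs_nbhs (conj oC Cx)).
apply/adic_nbhsP; exists N => y xy; apply: CV; apply: NC => n nN.
by apply/esym/truncate_eq; exact: vanish_le xy.
Qed.

Lemma from_limit_continuous : continuous from_limit.
Proof.
move=> y V /adic_nbhsP[N NV].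
have near_y : nbhs y [set z | forall n, (n < N)%N -> set_val z n = set_val y n].
  exact: initial_continuous (prod_discrete_cylinder (set_val y) N).
rewrite -[nbhs _ V]/(nbhs y (from_limit @^-1` V)).
apply: (@filterS _ _ (nbhs_filter y)) near_y => z zy; apply: NV => k i kin.
by rewrite tailsB /= /limit_tails zy // subrr.
Qed.

Lemma adic_is_inverse_limit : is_inverse_limit G transition.
Proof.
exists to_limit; split=> [x y n|]; first exact: truncateD.
split; first exact: to_limit_continuous.
exists from_limit; split; [exact: from_limit_continuous|exact: to_limitK|exact: from_limitK].
Qed.

End AdicInverseLimit.

(** * Continuum many pairwise incomparable sets of primes *)

Fixpoint prime_seq n : nat :=
  if n is m.+1 then s2val (prime_above (prime_seq m)) else 2.

Lemma prime_seq_prime n : prime (prime_seq n).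
Proof. by case: n => //= n; case: prime_above. Qed.

Lemma prime_seq_inj : injective prime_seq.
Proof.
have lt_seq : {homo prime_seq : m n / (m < n)%N}.
  by apply: homo_ltn => [|n /=]; [exact: ltn_trans|case: prime_above].
by apply: incn_inj; exact/leq_mono.
Qed.

(** The bit [a k] selects one prime from the [k]-th of infinitely many disjoint pairs. Where [a] and
    [b] differ, each set has a prime that the other lacks. *)
Definition prime_choice (a : nat -> bool) k : nat := prime_seq (k.*2 + a k).

Lemma prime_choice_prime a k : prime (prime_choice a k).
Proof. exact: prime_seq_prime. Qed.

Lemma prime_choice_neq a b n k : a n != b n -> prime_choice a k != prime_choice b n.
Proof.
apply: contra => /eqP /prime_seq_inj e.
have kn : k = n by lia.
by move: e; rewrite kn => /addnI; case: (a n); case: (b n).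
Qed.

Unset Implicit Arguments.

Theorem theorem1p2 (R : realType) :
  exists G : (nat -> bool) -> topologicalZmodType,
    [/\ forall a, polish R (G a) /\ non_archimedean (G a),
        forall a, [/\ separable_group (G a), torsionless (G a)
                    & aleph1_free (G a)],
        forall a, ~ iso_to_product_group (G a),
        forall a b, a <> b ->
          forall f : {additive G a -> G b},
            continuous f -> ~ (forall y, exists x, f x = y)
      & forall a, exists (A : nat -> zmodType)
                         (p : forall n, {additive A n.+1 -> A n}),
          (forall n, [/\ countable [set: A n], torsion_free (A n)
                       & completely_decomposable (A n)]) /\
          is_inverse_limit (G a) p].
Proof.
exists (fun a => adic R (prime_choice a) : topologicalZmodType).
have unim a := @adic_unimodular R _ (prime_choice_prime a).
split=> [a|a|a|a b ab|a].
- by split; [exact: adic_polish|exact: adic_non_archimedean].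
- have tl := unimodular_torsionless (unim a).
  by split; [exact: unimodular_separable (unim a)|exact: tl|exact: torsionless_aleph1_free tl].
- exact: adic_not_product (prime_choice_prime a).
- have [n abn] : exists n, a n != b n.
    apply: contrapT => ab_eq; apply: ab; apply/funext => n; apply/eqP.
    by apply: contraT => abn; case: ab_eq; exists n.
  apply: (adic_no_surjection (prime_choice_prime a) (prime_choice_prime b) (n := n)).
  by move=> k; exact: prime_choice_neq.
- exists (fun n => stage (prime_choice a) n), (@transition (prime_choice a)).
  split; last exact: adic_is_inverse_limit.
  move=> n; split; first exact: stage_countable.
    exact: stage_torsion_free.
  exact: stage_completely_decomposable.
Qed.
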